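(* Let $L$ be a finite-dimensional (left) Leibniz algebra over an arbitrary field $F$ and let $U$ be a subnormal subalgebra of $L$. Let $V$ be a finite-dimensional irreducible $L$-bimodule. Then all $U$-bimodule composition factors of $V$ (with $V$ regarded as a $U$-bimodule by restriction) are isomorphic as $U$-bimodules.
   Context: A (left) Leibniz algebra over a field $F$ is an $F$-vector space $L$ with a bilinear product $(a,b)\mapsto ab$ such that every left multiplication $\lambda_a\colon x\mapsto ax$ is a derivation, i.e. $a(xy)=(ax)y+x(ay)$ for all $a,x,y\in L$. A subalgebra is a subspace closed under the product. For subspaces $A,B\subseteq L$, $AB$ denotes the subspace spanned by all products $ab$ with $a\in A$, $b\in B$. An ideal of an algebra $A$ is a two-sided ideal, i.e. a subspace $I$ with $AI\subseteq I$ and $IA\subseteq I$. A subalgebra $U$ of $L$ is subnormal if there is a finite chain of subalgebras $L=U_0\supset U_1\supset\dots\supset U_n=U$ (with $n\ge 0$) such that each $U_i$ is an ideal of $U_{i-1}$. An $L$-bimodule is an $F$-vector space $V$ with bilinear left and right actions $(a,v)\mapsto av$ and $(v,a)\mapsto va$ of $L$ such that, for all $a,b\in L$ and $v\in V$: $a(bv)=(ab)v+b(av)$, $a(vb)=(av)b+v(ab)$, and $v(ab)=(va)b+a(vb)$. (Equivalently, $L\oplus V$ with $VV=0$ is a left Leibniz algebra, the split extension of $V$ by $L$.) A sub-bimodule is a subspace closed under both actions. A bimodule is irreducible if it is nonzero and its only sub-bimodules are $0$ and itself. Composition factors are the irreducible quotients in a composition series of sub-bimodules. *)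

(* Defs.v *)
From HB Require Import structures.
From mathcomp Require Import all_boot all_order all_algebra.
Set Implicit Arguments.
Unset Strict Implicit.
Unset Printing Implicit Defensive.
Import GRing.Theory.
Local Open Scope ring_scope.

HB.mixin Record Vector_isLeibniz (F : fieldType) L of Vector F L := {
  lbmul : L -> L -> L;
  lbmul_linearr : forall a, linear (lbmul a);
  lbmul_linearl : forall b, linear (lbmul^~ b);
  lbmul_leibniz : forall a x y,
    lbmul a (lbmul x y) = lbmul (lbmul a x) y + lbmul x (lbmul a y)
}.

(* As vectType is an interface for finite-dimensional spaces, so are the two
   structures below. *)
#[short(type="leibnizType")]
HB.structure Definition Leibniz (F : fieldType) :=
  {L of Vector_isLeibniz F L & Vector F L}.

HB.mixin Record Vector_isBimodule (F : fieldType) (L : leibnizType F) V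
    of Vector F V := {
  lact : L -> V -> V;
  ract : V -> L -> V;
  lact_linearr : forall a, linear (lact a);
  lact_linearl : forall v, linear (lact^~ v);
  ract_linearr : forall v, linear (ract v);
  ract_linearl : forall a, linear (ract^~ a);
  lact_lact : forall a b v,
    lact a (lact b v) = lact (lbmul a b) v + lact b (lact a v);
  lact_ract : forall a b v,
    lact a (ract v b) = ract (lact a v) b + ract v (lbmul a b);
  ract_lbmul : forall a b v,
    ract v (lbmul a b) = ract (ract v a) b + lact a (ract v b)
}.

#[short(type="bimodType")]
HB.structure Definition Bimodule (F : fieldType) (L : leibnizType F) :=
  {V of Vector_isBimodule F L V & Vector F V}.

Section Subalgebras.
Variables (F : fieldType) (L : leibnizType F).

Record subalg := SubAlg {
  subalg_vs :> {vspace L};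
  subalgM : {in subalg_vs &, forall a b, lbmul a b \in subalg_vs}
}.

Fact full_subalg_subproof :
  {in fullv &, forall a b : L, lbmul a b \in fullv}.
Proof. by move=> a b _ _; rewrite memvf. Qed.
Definition full_subalg := SubAlg full_subalg_subproof.

Definition ideal_of (I A : {vspace L}) : Prop :=
  [/\ (I <= A)%VS,
      {in A & I, forall a x, lbmul a x \in I} &
      {in I & A, forall x a, lbmul x a \in I}].

Definition subnormal (U : subalg) : Prop :=
  exists (n : nat) (C : nat -> subalg),
    [/\ C 0 = fullv :> {vspace L},
        C n = U :> {vspace L} &
        forall i, (i < n)%N -> ideal_of (C i.+1) (C i)].

End Subalgebras.

Section SubalgebraAsAlgebra.
Variables (F : fieldType) (L : leibnizType F) (U : subalg L).
Implicit Types a b x y : subvs_of U.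

Definition sub_lbmul a b : subvs_of U := vsproj U (lbmul (vsval a) (vsval b)).

Lemma vsval_lbmul a b : vsval (sub_lbmul a b) = lbmul (vsval a) (vsval b).
Proof. by rewrite vsprojK // subalgM ?subvsP. Qed.

Fact sub_lbmul_linearr a : linear (sub_lbmul a).
Proof.
move=> k x y; apply: val_inj => /=.
by rewrite !vsval_lbmul linearP lbmul_linearr.
Qed.

Fact sub_lbmul_linearl b : linear (sub_lbmul^~ b).
Proof.
move=> k x y; apply: val_inj => /=.
by rewrite !vsval_lbmul linearP lbmul_linearl.
Qed.

Fact sub_lbmul_leibniz a x y :
  sub_lbmul a (sub_lbmul x y) =
  sub_lbmul (sub_lbmul a x) y + sub_lbmul x (sub_lbmul a y).
Proof.
apply: val_inj => /=.
by rewrite !vsval_lbmul lbmul_leibniz.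
Qed.

HB.instance Definition _ := Vector_isLeibniz.Build F (subvs_of U)
  sub_lbmul_linearr sub_lbmul_linearl sub_lbmul_leibniz.

End SubalgebraAsAlgebra.

Definition restr (F : fieldType) (L : leibnizType F) (U : subalg L)
    (V : bimodType L) : Type := V.

Section Restriction.
Variables (F : fieldType) (L : leibnizType F) (U : subalg L) (V : bimodType L).
Local Notation restr := (restr U V).

HB.instance Definition _ := Vector.on restr.

Definition restr_lact (a : subvs_of U) (v : restr) : restr :=
  lact (vsval a) (v : V).
Definition restr_ract (v : restr) (a : subvs_of U) : restr :=
  ract (v : V) (vsval a).

Fact restr_lact_linearr a : linear (restr_lact a).
Proof. exact: lact_linearr. Qed.
Fact restr_lact_linearl v : linear (restr_lact^~ v).
Proof.
by move=> k x y; rewrite /restr_lact linearP; apply: (@lact_linearl _ _ V).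
Qed.
Fact restr_ract_linearr v : linear (restr_ract v).
Proof.
by move=> k x y; rewrite /restr_ract linearP; apply: (@ract_linearr _ _ V).
Qed.
Fact restr_ract_linearl a : linear (restr_ract^~ a).
Proof. exact: ract_linearl. Qed.
Fact restr_lact_lact a b v :
  restr_lact a (restr_lact b v) =
  restr_lact (lbmul a b) v + restr_lact b (restr_lact a v).
Proof. by rewrite /restr_lact vsval_lbmul; apply: (@lact_lact _ _ V). Qed.
Fact restr_lact_ract a b v :
  restr_lact a (restr_ract v b) =
  restr_ract (restr_lact a v) b + restr_ract v (lbmul a b).
Proof. by rewrite /restr_ract vsval_lbmul; apply: (@lact_ract _ _ V). Qed.
Fact restr_ract_lbmul a b v :
  restr_ract v (lbmul a b) =
  restr_ract (restr_ract v a) b + restr_lact a (restr_ract v b).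
Proof. by rewrite /restr_ract vsval_lbmul; apply: (@ract_lbmul _ _ V). Qed.

HB.instance Definition _ := Vector_isBimodule.Build F (subvs_of U) restr
  restr_lact_linearr restr_lact_linearl restr_ract_linearr restr_ract_linearl
  restr_lact_lact restr_lact_ract restr_ract_lbmul.

End Restriction.

Record subbimod (F : fieldType) (L : leibnizType F) (V : bimodType L) :=
  SubBimod {
    subbimod_vs :> {vspace V};
    subbimodLact : forall (a : L) v,
      v \in subbimod_vs -> lact a v \in subbimod_vs;
    subbimodRact : forall (a : L) v,
      v \in subbimod_vs -> ract v a \in subbimod_vs
  }.

Definition bimod_irreducible (F : fieldType) (L : leibnizType F)
    (V : bimodType L) : Prop :=
  ({:V} != 0)%VS /\
  forall W : subbimod V, W = 0%VS :> {vspace V} \/ W = fullv :> {vspace V}.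

Definition bimod_morphism (F : fieldType) (L : leibnizType F)
    (V W : bimodType L) (f : {linear V -> W}) : Prop :=
  (forall (a : L) v, f (lact a v) = lact a (f v)) /\
  (forall (a : L) v, f (ract v a) = ract (f v) a).

Definition bimod_iso (F : fieldType) (L : leibnizType F)
    (V W : bimodType L) : Prop :=
  exists f : {linear V -> W}, bimod_morphism f /\ bijective f.

Section SubBimoduleAsBimodule.
Variables (F : fieldType) (L : leibnizType F) (V : bimodType L).
Variable (W : subbimod V).
Implicit Types (a b : L) (v : subvs_of W).

Definition sub_lact a v : subvs_of W := vsproj W (lact a (vsval v)).
Definition sub_ract v a : subvs_of W := vsproj W (ract (vsval v) a).

Lemma vsval_lact a v : vsval (sub_lact a v) = lact a (vsval v).
Proof. by rewrite vsprojK // subbimodLact ?subvsP. Qed.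
Lemma vsval_ract v a : vsval (sub_ract v a) = ract (vsval v) a.
Proof. by rewrite vsprojK // subbimodRact ?subvsP. Qed.

Fact sub_lact_linearr a : linear (sub_lact a).
Proof.
move=> k x y; apply: val_inj => /=.
by rewrite !vsval_lact linearP lact_linearr.
Qed.
Fact sub_lact_linearl v : linear (sub_lact^~ v).
Proof.
move=> k x y; apply: val_inj => /=.
by rewrite !vsval_lact lact_linearl.
Qed.
Fact sub_ract_linearr v : linear (sub_ract v).
Proof.
move=> k x y; apply: val_inj => /=.
by rewrite !vsval_ract ract_linearr.
Qed.
Fact sub_ract_linearl a : linear (sub_ract^~ a).
Proof.
move=> k x y; apply: val_inj => /=.
by rewrite !vsval_ract linearP ract_linearl.
Qed.
Fact sub_lact_lact a b v :
  sub_lact a (sub_lact b v) = sub_lact (lbmul a b) v + sub_lact b (sub_lact a v).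
Proof.
by apply: val_inj => /=; rewrite !vsval_lact lact_lact.
Qed.
Fact sub_lact_ract a b v :
  sub_lact a (sub_ract v b) = sub_ract (sub_lact a v) b + sub_ract v (lbmul a b).
Proof.
apply: val_inj => /=.
by rewrite !(vsval_lact, vsval_ract) lact_ract.
Qed.
Fact sub_ract_lbmul a b v :
  sub_ract v (lbmul a b) = sub_ract (sub_ract v a) b + sub_lact a (sub_ract v b).
Proof.
apply: val_inj => /=.
by rewrite !(vsval_lact, vsval_ract) ract_lbmul.
Qed.

HB.instance Definition _ := Vector_isBimodule.Build F L (subvs_of W)
  sub_lact_linearr sub_lact_linearl sub_ract_linearr sub_ract_linearl
  sub_lact_lact sub_lact_ract sub_ract_lbmul.

End SubBimoduleAsBimodule.

(* The quotient V / W is carried by the complement W^C of W: a vector of W^C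
   stands for its class modulo W, and quot_pi W : V -> V / W is the projection
   onto W^C along W. Lemmas quot_pi_morphism, quot_pi_surj and quot_pi_eq0 state
   that quot_pi W is a surjective bimodule morphism with kernel W, which
   characterises V / W. *)
Section QuotientBimodule.
Variables (F : fieldType) (L : leibnizType F) (V : bimodType L).
Variable (W : subbimod V).

Definition quot : Type := subvs_of (W^C)%VS.
HB.instance Definition _ := Vector.on quot.

Definition quot_repr (x : quot) : V := vsval x.
Definition quot_pi (v : V) : quot := vsproj (W^C)%VS (daddv_pi W^C W v).

Fact quot_repr_linear : linear quot_repr.
Proof. exact: linearP. Qed.
HB.instance Definition _ :=
  GRing.isLinear.Build F quot V _ quot_repr quot_repr_linear.

Fact quot_pi_linear : linear quot_pi.
Proof. by move=> k u v; rewrite /quot_pi !linearP. Qed.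
HB.instance Definition _ :=
  GRing.isLinear.Build F V quot _ quot_pi quot_pi_linear.

Definition quot_lact (a : L) (x : quot) : quot := quot_pi (lact a (quot_repr x)).
Definition quot_ract (x : quot) (a : L) : quot := quot_pi (ract (quot_repr x) a).

Let capCW : (W^C :&: W = 0)%VS.
Proof. by rewrite capvC capv_compl. Qed.

Lemma quot_reprK : cancel quot_repr quot_pi.
Proof.
move=> x; apply: val_inj => /=; rewrite vsprojK ?memv_pi //.
by rewrite daddv_pi_id // subvsP.
Qed.

Lemma quot_pi_surj (x : quot) : exists v, quot_pi v = x.
Proof. by exists (quot_repr x); apply: quot_reprK. Qed.

Lemma quot_piK v : v - quot_repr (quot_pi v) \in W.
Proof.
rewrite /quot_repr vsprojK ?memv_pi //.
have vWC : (v \in W^C + W)%VS by rewrite addvC addv_complf memvf.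
by rewrite -{1}(daddv_pi_add capCW vWC) addrC addKr memv_pi.
Qed.

Lemma quot_pi_eq0 v : (quot_pi v == 0) = (v \in W).
Proof.
apply/eqP/idP => [pv0|vW].
  by have := quot_piK v; rewrite pv0 (linear0 quot_repr) subr0.
apply: val_inj; apply/eqP; rewrite -memv0 -capCW memv_cap subvsP /=.
by rewrite -[X in X \in _](subKr v) memvB // quot_piK.
Qed.

Let quot_pi_eq u v : u - v \in W -> quot_pi u = quot_pi v.
Proof. by rewrite -quot_pi_eq0 linearB subr_eq0 => /eqP. Qed.

Let lactB a (u v : V) : lact a (u - v) = lact a u - lact a v.
Proof. by rewrite -scaleN1r addrC lact_linearr scaleN1r addrC. Qed.
Let ractB a (u v : V) : ract (u - v) a = ract u a - ract v a.
Proof. by rewrite -scaleN1r addrC ract_linearl scaleN1r addrC. Qed.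

Lemma quot_pi_lact a v : quot_pi (lact a v) = quot_lact a (quot_pi v).
Proof. by apply: quot_pi_eq; rewrite -lactB subbimodLact ?quot_piK. Qed.
Lemma quot_pi_ract a v : quot_pi (ract v a) = quot_ract (quot_pi v) a.
Proof. by apply: quot_pi_eq; rewrite -ractB subbimodRact ?quot_piK. Qed.

Fact quot_lact_linearr a : linear (quot_lact a).
Proof. by move=> k x y; rewrite /quot_lact linearP lact_linearr linearP. Qed.
Fact quot_lact_linearl x : linear (quot_lact^~ x).
Proof. by move=> k a b; rewrite /quot_lact lact_linearl linearP. Qed.
Fact quot_ract_linearr x : linear (quot_ract x).
Proof. by move=> k a b; rewrite /quot_ract ract_linearr linearP. Qed.
Fact quot_ract_linearl a : linear (quot_ract^~ a).
Proof. by move=> k x y; rewrite /quot_ract linearP ract_linearl linearP. Qed.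
Fact quot_lact_lact a b x :
  quot_lact a (quot_lact b x) =
  quot_lact (lbmul a b) x + quot_lact b (quot_lact a x).
Proof.
case: (quot_pi_surj x) => v <-.
by rewrite -!quot_pi_lact lact_lact linearD.
Qed.
Fact quot_lact_ract a b x :
  quot_lact a (quot_ract x b) =
  quot_ract (quot_lact a x) b + quot_ract x (lbmul a b).
Proof.
case: (quot_pi_surj x) => v <-.
by rewrite -!(quot_pi_lact, quot_pi_ract) lact_ract linearD.
Qed.
Fact quot_ract_lbmul a b x :
  quot_ract x (lbmul a b) =
  quot_ract (quot_ract x a) b + quot_lact a (quot_ract x b).
Proof.
case: (quot_pi_surj x) => v <-.
by rewrite -!(quot_pi_lact, quot_pi_ract) ract_lbmul linearD.
Qed.

HB.instance Definition _ := Vector_isBimodule.Build F L quot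
  quot_lact_linearr quot_lact_linearl quot_ract_linearr quot_ract_linearl
  quot_lact_lact quot_lact_ract quot_ract_lbmul.

Lemma quot_pi_morphism : bimod_morphism quot_pi.
Proof. by split=> a v; [apply: quot_pi_lact | apply: quot_pi_ract]. Qed.

End QuotientBimodule.

Section CompositionFactors.
Variables (F : fieldType) (L : leibnizType F) (V : bimodType L).

Section Factor.
Variables (W2 W1 : subbimod V).

(* W1 :&: W2 as a sub-bimodule of the bimodule W2. *)
Definition subin_vs : {vspace subvs_of W2} :=
  (linfun (vsval : subvs_of W2 -> V) @^-1: W1)%VS.

Lemma mem_subin v : (v \in subin_vs) = (vsval v \in W1).
Proof. by rewrite -memv_preim lfunE. Qed.

Fact subin_lact (a : L) v : v \in subin_vs -> lact a v \in subin_vs.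
Proof. by rewrite !mem_subin vsval_lact; apply: subbimodLact. Qed.
Fact subin_ract (a : L) v : v \in subin_vs -> ract v a \in subin_vs.
Proof. by rewrite !mem_subin vsval_ract; apply: subbimodRact. Qed.

Definition subin : subbimod (subvs_of W2) := SubBimod subin_lact subin_ract.

(* The quotient W2 / (W1 :&: W2), which is W2 / W1 if W1 <= W2. *)
Definition bimod_factor : bimodType L := quot subin.
End Factor.

Definition composition_series (n : nat) (C : nat -> subbimod V) : Prop :=
  [/\ C 0 = 0%VS :> {vspace V},
      C n = fullv :> {vspace V} &
      forall i, (i < n)%N ->
        (C i <= C i.+1)%VS /\ bimod_irreducible (bimod_factor (C i.+1) (C i))].

Definition composition_factor (M : bimodType L) : Prop :=
  exists (n : nat) (C : nat -> subbimod V) (i : nat),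
    [/\ composition_series n C, (i < n)%N &
        bimod_iso M (bimod_factor (C i.+1) (C i))].

End CompositionFactors.

(* Main.v *)
Require Import Defs.
From mathcomp Require Import all_boot all_order all_algebra.
From Stdlib Require Import Classical.
From HB Require Import structures.
Set Implicit Arguments.
Unset Strict Implicit.
Unset Printing Implicit Defensive.
Import GRing.Theory.
Local Open Scope ring_scope.

(** The statement reduces to left actions, where it is Clifford theory.

    Right actions disappear because of the identity (va + av)b = 0, a
    consequence of the bimodule axioms. The vectors annihilated by the right
    action form a sub-bimodule. If V is irreducible, this sub-bimodule is V,
    and the right action is zero, or it is 0, and va = -av. In both cases
    va = e(av) for one scalar e ([irreducible_right_scalar]), so that
    sub-bimodules, irreducibility and isomorphisms only concern the left
    action, also over U and on all subquotients of V.

    Call V homogeneous over a subspace K of L if every simple K-section A/B of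
    V is isomorphic to one simple K-submodule W. Over L itself the irreducible
    V is homogeneous with W = V. It remains to go down one step of the
    subnormal chain ([homogeneous_ideal]): let U be an ideal of K, let V be
    homogeneous over K with reference W, and let M be a simple U-submodule of
    W. Let R be a maximal U-submodule containing M all of whose simple
    U-sections are isomorphic to M.
    - R is K-stable: for x in K the map v |-> xv induces a U-homomorphism from
      R onto (R + xR)/R, as u(xv) = (ux)v + x(uv) and ux lies in U. Hence the
      simple sections of R + xR are isomorphic to M, and maximality gives
      xR <= R ([maximal_isotypic_stable]).
    - R contains W, as it meets the simple K-module W in a K-submodule
      containing M.
    - R = V: otherwise choose a simple K-section S/R. It is a K-image of W, so
      its simple U-sections are isomorphic to M, against maximality.
    Two facts about the class of sections all of whose simple sections are
    isomorphic to M do the work: it is closed under homomorphic images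
    ([isotypic_image]) and under extensions ([isotypic_extension]). The latter
    takes the place of the Jordan-Hoelder theorem.

    Sections A/B are handled as pairs of subspaces of V, and a homomorphism
    into A/B as an endomorphism of V that is equivariant modulo B. Quotient
    bimodules only appear when the homogeneity of V is read as the
    isomorphism of its composition factors ([covers_factor_iso]). *)

(** * The right action on an irreducible bimodule *)

Section Actions.
Variables (F : fieldType) (L : leibnizType F) (V : bimodType L).

HB.instance Definition _ (a : L) :=
  GRing.isLinear.Build F V V _ (lact a) (lact_linearr a).
HB.instance Definition _ (v : V) :=
  GRing.isLinear.Build F L V _ (ract v) (ract_linearr v).

Lemma ractD (u v : V) (a : L) : ract (u + v) a = ract u a + ract v a.
Proof. by rewrite -[u in LHS]scale1r ract_linearl scale1r. Qed.

Definition ract_hom (v : V) : 'Hom(L, V) := linfun (ract v).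

Fact ract_hom_linear : linear ract_hom.
Proof.
move=> k u v; apply/lfunP=> a.
by rewrite add_lfunE scale_lfunE !lfunE /= ract_linearl.
Qed.
HB.instance Definition _ :=
  GRing.isLinear.Build F V 'Hom(L, V) _ ract_hom ract_hom_linear.

Definition ract_ann : {vspace V} := lker (linfun ract_hom).

Lemma ract_annP v : reflect (forall a : L, ract v a = 0) (v \in ract_ann).
Proof.
rewrite memv_ker lfunE /=; apply: (iffP eqP) => [v0 a | v0].
  by have := congr1 (fun h : 'Hom(L, V) => h a) v0; rewrite lfunE zero_lfunE.
by apply/lfunP=> a; rewrite zero_lfunE [LHS]lfunE /= v0.
Qed.

Fact ract_ann_lact (a : L) v : v \in ract_ann -> lact a v \in ract_ann.
Proof.
move=> /ract_annP v0; apply/ract_annP=> b.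
by have /esym := lact_ract a b v; rewrite !v0 linear0 addr0.
Qed.
Fact ract_ann_ract (a : L) v : v \in ract_ann -> ract v a \in ract_ann.
Proof. by move=> /ract_annP->; apply: mem0v. Qed.

(** Substituting the axiom v(ab) = (va)b + a(vb) into
    a(vb) = (av)b + v(ab) cancels a(vb) and leaves this identity. *)
Lemma ract_add_lact (a b : L) (v : V) : ract (ract v a + lact a v) b = 0.
Proof.
apply: (addIr (lact a (ract v b))).
by rewrite ractD add0r [RHS]lact_ract ract_lbmul addrCA addrA.
Qed.

Definition right_scalar (e : F) :=
  forall (v : V) (a : L), ract v a = e *: lact a v.

Lemma irreducible_right_scalar :
  bimod_irreducible V -> exists e, right_scalar e.
Proof.
move=> [_ /(_ (SubBimod ract_ann_lact ract_ann_ract)) /= [] annE].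
  exists (-1) => v a; rewrite scaleN1r; apply/eqP.
  rewrite -addr_eq0 -memv0 -annE; apply/ract_annP=> b; exact: ract_add_lact.
exists 0 => v a; rewrite scale0r; apply: (@ract_annP v _).
by rewrite annE memvf.
Qed.

(** * Sections of V under the left action *)

Definition stable (K : {vspace L}) (A : {vspace V}) : Prop :=
  {in K & A, forall x v, lact x v \in A}.

Definition simple_section (K : {vspace L}) (A B : {vspace V}) : Prop :=
  [/\ stable K A, stable K B, (B <= A)%VS, ~~ (A <= B)%VS &
      forall E, stable K E -> (B <= E)%VS -> (E <= A)%VS ->
        (E <= B)%VS \/ (A <= E)%VS].

Definition equivariant_mod (K : {vspace L}) (A B : {vspace V})
    (g : 'End(V)) : Prop :=
  {in K & A, forall u v, lact u (g v) - g (lact u v) \in B}.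

(** For a simple module M and a simple section A/B this is isomorphism: a
    homomorphism from M onto the nonzero A/B has kernel zero. Only surjectivity
    is recorded, because it passes to composites and images without the
    inverse maps that a symmetric notion would need. *)
Definition covers K (M A B : {vspace V}) : Prop :=
  exists2 g, equivariant_mod K M B g & (g @: M + B)%VS = A.

(** Quantifying over all simple sections, instead of asking for one
    composition series with factors M, makes passage to subsections
    immediate. *)
Definition isotypic K (M A B : {vspace V}) : Prop :=
  forall C D, simple_section K C D -> (B <= D)%VS -> (C <= A)%VS ->
    covers K M C D.

Lemma stable0 K : stable K 0%VS.
Proof. by move=> x v _ /[!memv0] /eqP->; rewrite linear0. Qed.

Lemma stablef K : stable K fullv.
Proof. by move=> x v _ _; apply: memvf. Qed.

Lemma stable_cap K A B : stable K A -> stable K B -> stable K (A :&: B).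
Proof.
by move=> sA sB x v xK /memv_capP[vA vB]; rewrite memv_cap sA ?sB.
Qed.

Lemma stable_add K A B : stable K A -> stable K B -> stable K (A + B).
Proof.
move=> sA sB x _ xK /memv_addP[a aA [b bB ->]].
by rewrite linearD memv_add ?sA ?sB.
Qed.

Lemma stable_sub (U K : {vspace L}) A :
  (U <= K)%VS -> stable K A -> stable U A.
Proof. by move=> /subvP UK sA x v /UK; apply: sA. Qed.

(** A minimal stable subspace strictly above B; finite dimension gives the
    descent, and excluded middle decides whether it continues. *)
Lemma exists_simple_section K A B :
    stable K A -> stable K B -> (B <= A)%VS -> ~~ (A <= B)%VS ->
  exists2 C, simple_section K C B & (C <= A)%VS.
Proof.
have [n] := ubnP (\dim A); elim: n A => // n IHn A.
rewrite ltnS => dimA sA sB BA nAB.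
have [[E [sE BE EA nEB nAE]] | noE] := classic (exists E,
    [/\ stable K E, (B <= E)%VS, (E <= A)%VS, ~~ (E <= B)%VS & ~~ (A <= E)%VS]).
  have dimE : (\dim E < n)%N.
    by apply: leq_trans dimA; rewrite (ltn_leqif (dimv_leqif_sup EA)).
  by have [C sC CE] := IHn E dimE sE sB BE nEB; exists C => //; apply: subv_trans EA.
exists A => //; split=> // E sE BE EA.
have [EB | nEB] := boolP (E <= B)%VS; first by left.
have [AE | nAE] := boolP (A <= E)%VS; first by right.
by case: noE; exists E.
Qed.

(** Here g induces a homomorphism from A'/B' onto a section containing A/B. A
    simple section C/D of A/B is then isomorphic to its preimage C'/D' in
    A'/B', which is covered by M. *)
Lemma isotypic_image K M A' B' A B (g : 'End(V)) :
    stable K A' -> (B' <= A')%VS -> equivariant_mod K A' B g ->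
    (g @: B' <= B)%VS -> (A <= g @: A' + B)%VS ->
  isotypic K M A' B' -> isotypic K M A B.
Proof.
move=> sA' B'A' eqg gB' /subvP gA' isoA' C D [sC sD DC nCD minCD] BD CA.
(* The preimage in A' of a submodule containing B is a submodule. *)
have stab_pre E : stable K E -> (B <= E)%VS -> stable K (A' :&: g @^-1: E)%VS.
  move=> sE /subvP BE x v xK; rewrite !memv_cap -!memv_preim => /andP[vA' gvE].
  rewrite sA' //= -[g _](subKr (lact x (g v))).
  by rewrite memvB ?sE //; apply/BE/eqg.
have BC := subv_trans BD DC.
(* C' maps onto C/D. *)
have inC' c : c \in C -> exists2 a, a \in (A' :&: g @^-1: C)%VS & c - g a \in D.
  move=> cC; have /gA'/memv_addP[_ /memv_imgP[a aA' ->] [b bB cE]] := subvP CA _ cC.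
  exists a; last by rewrite cE addrC addKr (subvP BD).
  by rewrite memv_cap aA' -memv_preim -[g a](addrK b) -cE memvB ?(subvP BC b).
have [] := isoA' (A' :&: g @^-1: C)%VS (A' :&: g @^-1: D)%VS.
- split; [exact: stab_pre | exact: stab_pre | | |].
  + by rewrite capvS // lpreimS.
  + apply: contra nCD => /subvP C'D'; apply/subvP=> c /inC'[a /C'D'].
    by rewrite memv_cap -memv_preim => /andP[_ gaD] ca; rewrite -(subrK (g a) c) memvD.
  move=> E sE /subvP D'E /subvP EC'.
  have EA' v : v \in E -> v \in A' by move/EC'/memv_capP=> [].
  have gEC v : v \in E -> g v \in C.
    by move/EC'; rewrite memv_cap -memv_preim => /andP[].
  (* Simplicity of C/D is applied to the image of E. *)
  have [] := minCD (g @: E + D)%VS.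
  + move=> x _ xK /memv_addP[_ /memv_imgP[v vE ->] [d dD ->]].
    rewrite linearD /= -[lact x (g v)](subrK (g (lact x v))) -addrA addrCA.
    by rewrite memv_add ?memv_img ?sE // memvD ?sD // (subvP BD) ?eqg ?EA'.
  + exact: addvSr.
  + rewrite subv_add DC andbT; apply/subvP=> _ /memv_imgP[v vE ->]; exact: gEC.
  + rewrite subv_add => /andP[/subvP gED _]; left; apply/subvP=> v vE.
    by rewrite memv_cap EA' // -memv_preim gED // memv_img.
  move/subvP=> CE; right; apply/subvP=> c; rewrite memv_cap -memv_preim.
  move=> /andP[cA' /CE/memv_addP[_ /memv_imgP[v vE ->] [d dD cE]]].
  have /D'E cvE : c - v \in (A' :&: g @^-1: D)%VS.
    by rewrite memv_cap memvB ?(EA' v) // -memv_preim linearB /= cE addrC addKr.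
  by rewrite -(subrK v c) memvD.
- apply/subvP=> v vB'; rewrite memv_cap -memv_preim (subvP B'A') //=.
  by rewrite (subvP BD) // (subvP gB') // memv_img.
- exact: capvSl.
move=> h eqh hM; exists (g \o h)%VF.
  move=> u w uK wM; rewrite comp_lfunE [_ (lact u w)]comp_lfunE.
  rewrite -[lact u _](subrK (g (lact u (h w)))) -addrA -linearB /=.
  have hwA' : h w \in A'.
    apply: (subvP (capvSl A' (g @^-1: C))).
    by rewrite -hM (subvP (addvSl _ _)) ?memv_img.
  rewrite memvD //; first exact/(subvP BD)/eqg.
  by have := eqh u w uK wM; rewrite memv_cap -memv_preim => /andP[].
apply/eqP; rewrite eqEsubv; apply/andP; split.
  rewrite subv_add DC andbT limg_comp.
  have /limgS-/(_ _ g) := addvSl (h @: M) (A' :&: g @^-1: D).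
  rewrite hM => /subv_trans->//; apply/subvP=> _ /memv_imgP[v + ->].
  by rewrite memv_cap -memv_preim => /andP[].
apply/subvP=> c /inC'[a]; rewrite -hM.
move=> /memv_addP[_ /memv_imgP[w wM ->] [d + ->]].
rewrite memv_cap -memv_preim => /andP[_ gdD] caD.
rewrite -(subrK (g (h w + d)) c) linearD /= addrCA memv_add //.
  by rewrite -[g (h w)]comp_lfunE memv_img.
by rewrite memvD // -linearD.
Qed.

Lemma isotypicS K M A B A1 B1 :
  (A1 <= A)%VS -> (B <= B1)%VS -> isotypic K M A B -> isotypic K M A1 B1.
Proof.
move=> A1A BB1 isoA C D sCD B1D CA1.
by apply: isoA sCD _ _; [apply: subv_trans B1D | apply: subv_trans A1A].
Qed.

(** For a simple section C/D the submodule D + (C :&: R) is D or C. If it is C,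
    then C/D is isomorphic to a section of R; if it is D, then C/D is
    isomorphic to (C + R)/(D + R), a section of S/R. *)
Lemma isotypic_extension K M S R B :
    stable K B -> stable K R -> (B <= R)%VS -> (R <= S)%VS ->
  isotypic K M R B -> isotypic K M S R -> isotypic K M S B.
Proof.
move=> sB sR BR RS isoR isoS C D sCD BD CS.
suff: isotypic K M C D by apply.
have [sC sD DC nCD minCD] := sCD.
have [||| CRD | CDCR] := minCD (D + C :&: R)%VS.
- by apply: stable_add => //; apply: stable_cap.
- exact: addvSl.
- by rewrite subv_add DC capvSl.
- have /subvP{}CRD : (C :&: R <= D)%VS by apply: subv_trans CRD; apply: addvSr.
  have isoRC : isotypic K M (R + C) (R + D).
    by apply: isotypicS isoS; rewrite ?addvSl // subv_add RS.
  have piR v : v \in (R + C)%VS -> v - addv_pi2 R C v \in R.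
    by move/addv_pi1_pi2=> {1}<-; rewrite addrK memv_pi1.
  (* The projection of R + C onto C along a complement of C :&: R in R is
     linear but not equivariant; it moves vectors by elements of R, so its
     defect lies in C :&: R, hence in D. *)
  apply: (@isotypic_image _ _ _ _ _ _ (addv_pi2 R C)) isoRC.
  + exact: stable_add.
  + exact: addvS.
  + move=> u v uK vRC; apply: CRD.
    rewrite memv_cap memvB ?sC ?memv_pi2 //=.
    have -> : lact u (addv_pi2 R C v) - addv_pi2 R C (lact u v) =
       lact u v - addv_pi2 R C (lact u v) - lact u (v - addv_pi2 R C v).
      by rewrite linearB /= opprB [RHS]addrC addrA subrK.
    by rewrite memvB ?piR ?sR ?piR // (stable_add sR sC).
  + apply/subvP=> _ /memv_imgP[v vRD ->].
    have vRC : v \in (R + C)%VS by apply: subvP vRD; apply: addvS.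
    have [r rR [d dD vE]] := memv_addP vRD.
    rewrite -(subrK d (addv_pi2 R C v)) memvD // CRD // memv_cap.
    rewrite memvB ?memv_pi2 ?(subvP DC) //= -opprB memvN.
    have -> : d - addv_pi2 R C v = (v - addv_pi2 R C v) - r.
      by rewrite vE addrAC [r + d]addrC addrK.
    by rewrite memvB ?piR.
  apply/subvP=> c cC; have cRC : c \in (R + C)%VS by apply: subvP cC; apply: addvSr.
  rewrite -[X in X \in _](subrK (addv_pi2 R C c)) addrC memv_add ?memv_img //.
  rewrite CRD // memv_cap memvB ?memv_pi2 //=; exact: piR.
apply: (@isotypic_image _ _ _ _ _ _ \1%VF) isoR => //.
- by move=> u v _ _; rewrite !lfunE subrr mem0v.
- by rewrite lim1g.
by rewrite lim1g addvC; apply: subv_trans CDCR _; rewrite addvS ?capvSr.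
Qed.

Lemma isotypic_simple K M : simple_section K M 0 -> isotypic K M M 0.
Proof.
move=> [_ _ _ nM0 minM] C D [sC sD DC nCD _] _ CM.
have nC0 : ~~ (C <= 0)%VS by apply: contra nCD => /subv_trans->//; apply: sub0v.
have MC : (M <= C)%VS.
  by have [C0|] := minM C sC (sub0v C) CM; rewrite ?C0 in nC0 *.
have D0 : (D <= 0)%VS.
  have [//|/(subv_trans CM)] := minM D sD (sub0v D) (subv_trans DC CM).
  by rewrite (negPf nCD).
exists \1%VF; first by move=> u v _ _; rewrite !lfunE subrr mem0v.
by rewrite lim1g; apply/eqP; rewrite eqEsubv subv_add MC DC (subv_trans CM) ?addvSl.
Qed.

Lemma exists_maximal_isotypic K M : stable K M -> isotypic K M M 0 ->
  exists R, [/\ stable K R, (M <= R)%VS, isotypic K M R 0 &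
    forall S, stable K S -> (R <= S)%VS -> isotypic K M S 0 -> (S <= R)%VS].
Proof.
move=> sM isoM; pose good R := [/\ stable K R, (M <= R)%VS & isotypic K M R 0].
suff ext n R : good R -> (\dim {:V} < n + \dim R)%N ->
    exists2 R', good R' & forall S, good S -> (R' <= S)%VS -> (S <= R')%VS.
  have [|R [sR MR isoR] maxR] := ext (\dim {:V}).+1 M _ (leq_addr _ _).
    by split.
  exists R; split=> // S sS RS isoS; apply: maxR => //.
  by split=> //; apply: subv_trans RS.
elim: n R => [|n IHn] R gR dimR.
  by move: dimR; rewrite ltnNge dimvS ?subvf.
have [[S [gS RS nSR]] | noS] :=
    classic (exists S, [/\ good S, (R <= S)%VS & ~~ (S <= R)%VS]).
  apply: IHn gS _; apply: leq_trans dimR _; rewrite addSnnS leq_add2l.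
  by rewrite (ltn_leqif (dimv_leqif_sup RS)).
exists R => // S gS RS; have [//|nSR] := boolP (S <= R)%VS.
by case: noS; exists S.
Qed.

Lemma equivariant_modS (U K : {vspace L}) A B g :
  (U <= K)%VS -> equivariant_mod K A B g -> equivariant_mod U A B g.
Proof. by move=> /subvP UK eqg u v /UK; apply: eqg. Qed.

(** For x in K, left multiplication by x is U-equivariant modulo R, since
    u(xv) - x(uv) = (ux)v with ux in U. So R + xR is an extension of R by an
    image of R, and cannot be larger than R. *)
Lemma maximal_isotypic_stable (U K : {vspace L}) M R :
    {in U & K, forall u x, lbmul u x \in U} ->
    stable U R -> isotypic U M R 0 ->
    (forall S, stable U S -> (R <= S)%VS -> isotypic U M S 0 -> (S <= R)%VS) ->
  stable K R.
Proof.
move=> ideU sR isoR maxR x v xK vR.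
have eqx : equivariant_mod U R R (linfun (lact x)).
  move=> u w uU wR; rewrite !lfunE /= [lact u (lact x w)]lact_lact addrK.
  by rewrite sR ?ideU.
suff SR : (R + linfun (lact x) @: R <= R)%VS.
  apply: (subvP SR); apply: subvP (addvSr _ _) _ _.
  by rewrite -[lact x v](lfunE (lact x)) memv_img.
apply: maxR; last 1 first.
- apply: (isotypic_extension (@stable0 U) sR) => //; rewrite ?sub0v ?addvSl //.
  apply: (isotypic_image sR _ eqx) isoR; rewrite ?sub0v // ?limg0 ?sub0v //.
  by rewrite addvC.
- move=> u _ uU /memv_addP[r rR [_ /memv_imgP[w wR ->] ->]].
  rewrite linearD /= -[X in _ + X](subrK (linfun (lact x) (lact u w))).
  rewrite addrA memv_add //; last by rewrite memv_img ?sR.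
  by rewrite memvD ?sR //; apply: eqx.
exact: addvSl.
Qed.

(** * Descent along the subnormal chain *)

Definition homogeneous K : Prop :=
  exists2 W, simple_section K W 0 & isotypic K W fullv 0.

(** The descent step: the maximal M-isotypic submodule R is K-stable, contains
    the reference module W of K, and therefore absorbs every simple K-section
    above it, as such a section is an image of W. *)
Lemma homogeneous_ideal (U K : {vspace L}) :
  ideal_of U K -> homogeneous K -> homogeneous U.
Proof.
move=> [UK _ idealU] [W sW isoV]; have [stW _ _ nW0 minW] := sW.
have [M sM MW] :=
  exists_simple_section (stable_sub UK stW) (@stable0 U) (sub0v _) nW0.
have [stM _ _ nM0 _] := sM; exists M => //.
have [R [sR MR isoR maxR]] := exists_maximal_isotypic stM (isotypic_simple sM).
have sKR : stable K R := maximal_isotypic_stable idealU sR isoR maxR.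
have WR : (W <= R)%VS.
  have [|||WR0|] := minW (W :&: R)%VS; rewrite ?sub0v ?capvSl //.
  - exact: stable_cap.
  - by case/negP: nM0; apply: subv_trans WR0; rewrite subv_cap MW.
  by rewrite subv_cap => /andP[].
suff RV : (fullv <= R)%VS by apply: isotypicS isoR.
apply/negbNE/negP=> nVR.
have [S sS _] := exists_simple_section (@stablef K) sKR (subvf R) nVR.
have [stS _ RS nSR _] := sS.
have [g eqg gW] := isoV S R sS (sub0v R) (subvf S).
case/negP: nSR; apply: maxR => //; first exact: stable_sub stS.
apply: (isotypic_extension (@stable0 U) sR (sub0v R) RS isoR).
apply: (@isotypic_image U M W 0 S R g); rewrite ?limg0 ?sub0v ?gW //.
- exact: stable_sub stW.
- exact: equivariant_modS eqg.
exact: isotypicS WR (subvv _) isoR.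
Qed.

Lemma homogeneous_subnormal (U : subalg L) :
  subnormal U -> homogeneous fullv -> homogeneous U.
Proof.
move=> [n [C [C0 Cn idC]]] homL; rewrite -Cn.
elim: n {Cn} idC => [|n IHn] idC; first by rewrite C0.
by apply: homogeneous_ideal (idC n _) _ => //; apply: IHn => i /ltnW; apply: idC.
Qed.

(** * Bimodules whose right action is a multiple of the left one *)

Section RightScalar.
Variable e : F.
Hypothesis ractE : right_scalar e.

Lemma stable_ract A (a : L) v : stable fullv A -> v \in A -> ract v a \in A.
Proof. by move=> sA vA; rewrite ractE memvZ // sA ?memvf. Qed.

Lemma stable_lact A (a : L) v : stable fullv A -> v \in A -> lact a v \in A.
Proof. by apply; apply: memvf. Qed.

Definition stable_subbimod A (sA : stable fullv A) : subbimod V :=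
  SubBimod (fun a v => @stable_lact A a v sA) (fun a v => @stable_ract A a v sA).

Lemma irreducible_simple_section :
  bimod_irreducible V -> simple_section fullv fullv 0.
Proof.
move=> [nV0 irrV]; split; [exact: stablef | exact: stable0 | exact: sub0v | |].
  by rewrite subv0.
move=> E sE _ _; have [/= ->|/= ->] := irrV (stable_subbimod sE); first by left.
by right.
Qed.

Lemma irreducible_homogeneous : bimod_irreducible V -> homogeneous fullv.
Proof.
move/irreducible_simple_section=> sV; exists fullv => //.
exact: isotypic_simple.
Qed.

End RightScalar.

(** * Composition factors as sections *)

Section FactorProjection.
Variables C D : subbimod V.

(** The projection of C onto C / (C :&: D), extended to V so that it composes
    with endomorphisms of V; it is meaningful on C only. *)
Definition factor_pi (v : V) : bimod_factor C D :=
  quot_pi (subin C D) (vsproj C v).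

Fact factor_pi_linear : linear factor_pi.
Proof. by move=> k u v; rewrite /factor_pi !linearP. Qed.
HB.instance Definition _ :=
  GRing.isLinear.Build F V (bimod_factor C D) _ factor_pi factor_pi_linear.

Lemma factor_pi_surj (x : bimod_factor C D) :
  exists2 v, v \in C & factor_pi v = x.
Proof.
have [z <-] := quot_pi_surj x; exists (vsval z); first exact: subvsP.
by rewrite /factor_pi vsvalK.
Qed.

Lemma factor_pi_eq0 v : v \in C -> (factor_pi v == 0) = (v \in D).
Proof. by move=> vC; rewrite quot_pi_eq0 mem_subin vsprojK. Qed.

Lemma factor_pi_lact (a : L) v :
  v \in C -> factor_pi (lact a v) = lact a (factor_pi v).
Proof.
by move=> vC; rewrite -[RHS]quot_pi_lact -[v in LHS](vsprojK vC).
Qed.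

Lemma factor_pi_ract (a : L) v :
  v \in C -> factor_pi (ract v a) = ract (factor_pi v) a.
Proof.
by move=> vC; rewrite -[RHS]quot_pi_ract -[v in LHS](vsprojK vC).
Qed.

End FactorProjection.

Section FactorsOfRightScalar.
Variable e : F.
Hypothesis ractE : right_scalar e.

Lemma factor_simple_section (C D : subbimod V) :
    (D <= C)%VS -> bimod_irreducible (bimod_factor C D) ->
  simple_section fullv C D.
Proof.
move=> DC [nQ0 irrQ]; split=> //.
- by move=> a v _; apply: subbimodLact.
- by move=> a v _; apply: subbimodLact.
- apply: contra nQ0 => /subvP CD; rewrite -subv0; apply/subvP=> x _.
  have [v vC <-] := factor_pi_surj x.
  by rewrite memv0 factor_pi_eq0 ?CD.
move=> E sE /subvP DE /subvP EC.
pose W := (linfun (factor_pi C D) @: E)%VS.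
have inW v : v \in C -> factor_pi C D v \in W -> v \in E.
  move=> vC /memv_imgP[w wE]; rewrite lfunE /= => /eqP.
  rewrite -subr_eq0 -linearB factor_pi_eq0; last by rewrite memvB ?(EC w).
  by move/DE=> vwE; rewrite -(subrK w v) memvD.
have WL (a : L) x : x \in W -> lact a x \in W.
  move=> /memv_imgP[w wE ->]; rewrite lfunE /= -factor_pi_lact ?EC //.
  by rewrite -[factor_pi _ _ _]lfunE memv_img ?sE ?memvf.
have WR (a : L) x : x \in W -> ract x a \in W.
  move=> /memv_imgP[w wE ->]; rewrite lfunE /= -factor_pi_ract ?EC //.
  by rewrite ractE -[factor_pi _ _ _]lfunE memv_img ?memvZ ?sE ?memvf.
have [/= W0|/= Wf] := irrQ (SubBimod WL WR); [left | right]; apply/subvP=> v vX.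
  rewrite -(@factor_pi_eq0 C D) ?EC // -memv0 -W0 -[factor_pi _ _ _]lfunE.
  exact: memv_img.
by apply: inW => //; rewrite Wf memvf.
Qed.

Lemma covers_factor_iso (W : {vspace V}) (sW : stable fullv W)
    (C D : subbimod V) :
    simple_section fullv W 0 -> simple_section fullv C D -> covers fullv W C D ->
  bimod_iso (subvs_of (stable_subbimod ractE sW)) (bimod_factor C D).
Proof.
move=> [_ _ _ _ minW] [_ sD DC nCD _] [g eqg gW].
set X := stable_subbimod ractE sW.
have gC w : w \in W -> g w \in C.
  by move=> wW; rewrite -gW (subvP (addvSl _ _)) ?memv_img.
have sK : stable fullv (W :&: g @^-1: D)%VS.
  move=> a w aL; rewrite !memv_cap -!memv_preim => /andP[wW gwD].
  rewrite sW //= -[g _](subKr (lact a (g w))).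
  by rewrite memvB ?sD ?eqg.
(* The kernel is 0 or W, and W would force C = D. *)
have inj_g w : w \in W -> g w \in D -> w = 0.
  have [|||/subvP W0|] := minW (W :&: g @^-1: D)%VS; rewrite ?sub0v ?capvSl //.
    by move=> wW gwD; apply/eqP; rewrite -memv0 W0 // memv_cap wW -memv_preim.
  rewrite subv_cap subvv => /subvP WD; case/negP: nCD.
  rewrite -gW subv_add subvv andbT; apply/subvP=> _ /memv_imgP[v /WD + ->].
  by rewrite -memv_preim.
pose f (x : subvs_of X) : bimod_factor C D := factor_pi C D (g (vsval x)).
have f_lin : linear f by move=> k x y; rewrite /f !linearP.
pose fl : {linear subvs_of X -> bimod_factor C D} :=
  HB.pack f (GRing.isLinear.Build _ _ _ _ f f_lin).
have fL (a : L) (x : subvs_of X) : f (lact a x) = lact a (f x).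
  have xW := subvsP x; rewrite /f -factor_pi_lact ?gC //.
  apply/esym/eqP; rewrite -subr_eq0 -linearB vsval_lact.
  rewrite factor_pi_eq0; first by rewrite eqg ?memvf.
  by rewrite memvB ?subbimodLact ?gC // sW ?memvf.
exists fl; split; [split=> //= a x|].
  have xW := subvsP x.
  rewrite -[in RHS]factor_pi_ract ?gC // /f vsval_ract !ractE !linearZ /=.
  by rewrite factor_pi_lact ?gC // -fL /f vsval_lact.
have f_inj : injective f.
  move=> x y /eqP; rewrite -subr_eq0 -(linearB fl) /= factor_pi_eq0 ?gC ?subvsP //.
  move=> gD; apply/eqP; rewrite -subr_eq0; apply/eqP/val_inj.
  exact: inj_g (subvsP _) gD.
have f_surj y : exists x, f x == y.
  have [v + <-] := factor_pi_surj y.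
  rewrite -gW => /memv_addP[_ /memv_imgP[w wW ->] [d dD ->]].
  exists (vsproj X w); rewrite -subr_eq0 -linearB /= vsprojK //.
  by rewrite opprD addNKr factor_pi_eq0 memvN // (subvP DC).
exists (fun y => xchoose (f_surj y)) => [x | y].
  by apply: f_inj; apply/eqP/(xchooseP (f_surj _)).
exact/eqP/(xchooseP (f_surj _)).
Qed.

End FactorsOfRightScalar.

End Actions.

(** * Restriction to a subalgebra *)

Section Restriction.
Variables (F : fieldType) (L : leibnizType F) (U : subalg L) (V : bimodType L).

Lemma stable_restr (A : {vspace V}) :
  stable (V := restr U V) fullv A <-> stable (V := V) U A.
Proof.
split=> sA x v xU vA; last exact: sA (subvsP x) vA.
by have := sA (vsproj U x) v (memvf _) vA; rewrite /lact /= /restr_lact vsprojK.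
Qed.

Lemma simple_section_restr (A B : {vspace V}) :
  simple_section (V := restr U V) fullv A B <-> simple_section (V := V) U A B.
Proof.
split=> -[sA sB BA nAB minA]; split=> //; try exact/stable_restr.
  by move=> E /stable_restr; apply: minA.
by move=> E /stable_restr; apply: minA.
Qed.

Lemma homogeneous_restr :
  homogeneous V U -> homogeneous (restr U V) fullv.
Proof.
move=> [W sW isoV]; exists W; first exact/simple_section_restr.
move=> C D /simple_section_restr sCD D0 CV.
have [g eqg gW] := isoV C D sCD D0 CV; exists g => // u w _ wW.
exact: eqg (subvsP u) wW.
Qed.

Lemma right_scalar_restr e :
  right_scalar V e -> right_scalar (restr U V) e.
Proof. by move=> ractE v a; apply: ractE. Qed.

End Restriction.

(** * Isomorphism of the composition factors *)

Section Isomorphism.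
Variables (F : fieldType) (L : leibnizType F).

Lemma bimod_iso_sym (V W : bimodType L) : bimod_iso V W -> bimod_iso W V.
Proof.
move=> [f [[fL fR] [g fK gK]]].
have g_lin : linear g by move=> k x y; apply: (can_inj fK); rewrite linearP !gK.
pose gl : {linear W -> V} := HB.pack g (GRing.isLinear.Build _ _ _ _ g g_lin).
exists gl; split; last by exists f.
by split=> a v /=; apply: (can_inj fK); rewrite ?fL ?fR !gK.
Qed.

Lemma bimod_iso_trans (V W X : bimodType L) :
  bimod_iso V W -> bimod_iso W X -> bimod_iso V X.
Proof.
move=> [f [[fL fR] f_bij]] [g [[gL gR] g_bij]].
exists (g \o f); split; last exact: bij_comp.
by split=> a v /=; rewrite ?fL ?gL ?fR ?gR.
Qed.

(** The common composition factor X is the reference module of the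
    homogeneous bimodule, with its right action. *)
Lemma homogeneous_factor_iso (V : bimodType L) e : right_scalar V e ->
    homogeneous V fullv ->
  exists X : bimodType L, forall M, composition_factor V M -> bimod_iso X M.
Proof.
move=> ractE [W sW isoV]; have [stW _ _ _ _] := sW.
exists (subvs_of (stable_subbimod ractE stW)).
move=> M [n [C [i [[_ _ serC] ltin isoM]]]].
have [CC irrC] := serC i ltin.
have sC := factor_simple_section ractE CC irrC.
apply: bimod_iso_trans (bimod_iso_sym isoM).
apply: covers_factor_iso => //; apply: isoV sC _ _; [exact: sub0v | exact: subvf].
Qed.

End Isomorphism.

Theorem theorem2p2 (F : fieldType) (L : leibnizType F) (U : subalg L)
    (V : bimodType L) (subnU : subnormal U) (irrV : bimod_irreducible V)
    (M N : bimodType (subvs_of U))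
    (facM : composition_factor (restr U V) M)
    (facN : composition_factor (restr U V) N) :
  bimod_iso M N.
Proof.
have [e ractE] := irreducible_right_scalar irrV.
have homU := homogeneous_subnormal subnU (irreducible_homogeneous ractE irrV).
have [X isoX] :=
  homogeneous_factor_iso (right_scalar_restr ractE) (homogeneous_restr homU).
exact: bimod_iso_trans (bimod_iso_sym (isoX M facM)) (isoX N facN).
Qed.
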